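(* Let $n=2m+2$ with $m\ge 1$. Consider the balanced double-star graph $\mathcal{G}_{\mathrm{ds}}$ with two center nodes $c_1,c_2$, two disjoint leaf sets $\mathcal{L}_1$ and $\mathcal{L}_2$ of size $m$, edges between $c_1$ and every node in $\mathcal{L}_1$, edges between $c_2$ and every node in $\mathcal{L}_2$, and one edge between $c_1$ and $c_2$. Set $$a:=\frac{1}{m+2},\quad b:=\frac{m+1}{m+2},\quad \alpha:=\frac{1}{2m},\quad \beta:=1-\frac{1}{2m}.$$ After ordering the nodes as $(\mathcal{L}_1,c_1,c_2,\mathcal{L}_2)$, define $$\mathbf{W}_{\mathrm{ds}}:=\begin{bmatrix} b\mathbf{I}_m & a\mathbf{1}_m & 0 & 0\\ a\mathbf{1}_m^\top & a & a & 0\\ 0 & a & a & a\mathbf{1}_m^\top\\ 0&0&a\mathbf{1}_m & b\mathbf{I}_m\end{bmatrix},\qquad \widetilde{\mathbf{W}}_{\mathrm{ds}}:=\begin{bmatrix} \beta\mathbf{I}_m & \alpha\mathbf{1}_m & 0 & 0\\ \alpha\mathbf{1}_m^\top & \frac14 & \frac14 & 0\\ 0 & \frac14 & \frac14 & \alpha\mathbf{1}_m^\top\\ 0&0&\alpha\mathbf{1}_m & \beta\mathbf{I}_m\end{bmatrix}.$$ Both $\mathbf{W}_{\mathrm{ds}}$ and $\widetilde{\mathbf{W}}_{\mathrm{ds}}$ are mixing matrices on $\mathcal{G}_{\mathrm{ds}}$, whose diameter is $D_{\mathcal{G}_{\mathrm{ds}}}=3$. Their spectral quantities satisfy $$\lambda_{\mathbf{W}_{\mathrm{ds}}}=\frac{m+1+\sqrt{m^2+6m+1}}{2(m+2)},\qquad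 \tau_{\mathbf{W}_{\mathrm{ds}}}=\frac{(m+2)\left(m+3+\sqrt{m^2+6m+1}\right)}{4}=\Theta(n^2),$$ $$\lambda_{\widetilde{\mathbf{W}}_{\mathrm{ds}}}=\frac{1-\frac{1}{2m}+\sqrt{1+\frac{1}{4m^2}}}{2},\qquad \tau_{\widetilde{\mathbf{W}}_{\mathrm{ds}}}=2m+1+\sqrt{4m^2+1}=\Theta(n).$$
   Context: $\mathbf{I}_m$ is the $m\times m$ identity and $\mathbf{1}_m$ the all-ones vector in $\mathbb{R}^m$. A mixing matrix on a connected undirected graph $\mathcal{G}$ with $n$ nodes is an $n\times n$ real matrix that is entrywise nonnegative, symmetric, doubly stochastic, and such that for all $i\ne j$, its $(i,j)$ entry is positive if and only if $\{i,j\}$ is an edge of $\mathcal{G}$. With $\mathbf{J}=\mathbf{1}\mathbf{1}^\top/n$ and $\|\cdot\|_2$ the spectral norm, $\lambda_{\mathbf{W}}:=\|\mathbf{W}-\mathbf{J}\|_2$ and $\tau_{\mathbf{W}}:=1/(1-\lambda_{\mathbf{W}})$ when $\lambda_{\mathbf{W}}<1$. $\Theta$ is as $m\to\infty$ with universal constants. *)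

(* Defs.v *)
From mathcomp Require Import all_boot all_order all_algebra.
From mathcomp Require Import all_classical all_reals all_analysis.

Set Implicit Arguments.
Unset Strict Implicit.
Unset Printing Implicit Defensive.

Import Order.TTheory GRing.Theory Num.Theory.
Import numFieldNormedType.Exports.

Local Open Scope ring_scope.

Section Graphs.
Variables (T : finType) (e : rel T).

Definition simple_connected_graph : Prop :=
  [/\ symmetric e, irreflexive e & forall u v, connect e u v].

Definition walk (u v : T) (k : nat) : bool :=
  [exists p : k.-tuple T, path e u p && (last u p == v)].

(* Two connected vertices are joined by a walk of length < #|T|, so the search
   range below is exhaustive; the value is #|T| for unconnected vertices. *)
Definition graph_dist (u v : T) : nat := find (walk u v) (iota 0 #|T|).

Definition diameter : nat := (\max_(u : T) \max_(v : T) graph_dist u v)%N.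

End Graphs.

Section MixingMatrices.
Variable R : realType.

Definition doubly_stochastic n (W : 'M[R]_n) : Prop :=
  [/\ forall i j, 0 <= W i j,
      forall i, \sum_j W i j = 1
    & forall j, \sum_i W i j = 1].

Definition mixing_matrix n (e : rel 'I_n) (W : 'M[R]_n) : Prop :=
  [/\ forall i j, 0 <= W i j,
      W^T = W,
      doubly_stochastic W
    & forall i j, i != j -> (0 < W i j) = e i j].

Definition euclidean_norm n (x : 'cV[R]_n) : R :=
  Num.sqrt (\sum_i x i 0 ^+ 2).

(* The operator norm induced by the Euclidean norm. The set is nonempty and
   bounded above, so this sup is a genuine least upper bound. *)
Definition spectral_norm n (A : 'M[R]_n) : R :=
  sup [set euclidean_norm (A *m x) | x in [set x | euclidean_norm x <= 1]]%classic.

Definition averaging_mx n : 'M[R]_n :=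
  n%:R^-1 *: ((const_mx 1 : 'cV[R]_n) *m (const_mx 1 : 'cV[R]_n)^T).

Definition lambda_mix n (W : 'M[R]_n) : R := spectral_norm (W - averaging_mx n).

(* Meaningful only when lambda_mix W < 1. *)
Definition tau_mix n (W : 'M[R]_n) : R := 1 / (1 - lambda_mix W).

End MixingMatrices.

Section DoubleStar.
Variable m : nat.

(* Vertices are the 2m + 2 ordinals of 'I_((m + 1) + (1 + m)), the four
   summands being, in this order, L1, {c1}, {c2}, L2. *)

Definition ds_leaf1 (i : 'I_m) : 'I_((m + 1) + (1 + m)) :=
  lshift (1 + m) (lshift 1 i).
Definition ds_center1 : 'I_((m + 1) + (1 + m)) :=
  lshift (1 + m) (rshift m ord0).
Definition ds_center2 : 'I_((m + 1) + (1 + m)) :=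
  rshift (m + 1) (lshift m ord0).
Definition ds_leaf2 (i : 'I_m) : 'I_((m + 1) + (1 + m)) :=
  rshift (m + 1) (rshift 1 i).

Definition ds_arc (u v : 'I_((m + 1) + (1 + m))) : bool :=
  [|| (u == ds_center1) && [exists i, v == ds_leaf1 i],
      (u == ds_center2) && [exists i, v == ds_leaf2 i]
    | (u == ds_center1) && (v == ds_center2)].

Definition ds_edge : rel 'I_((m + 1) + (1 + m)) :=
  fun u v => ds_arc u v || ds_arc v u.

Variable R : realType.

(* The matrix with leaf diagonal entries p, leaf-center entries q and
   center-center entries (diagonal included) r, written in 2 x 2 blocks along
   (L1, c1) and (c2, L2). *)
Definition ds_mx (p q r : R) : 'M[R]_((m + 1) + (1 + m)) :=
  block_mx
    (block_mx p%:M (const_mx q) (const_mx q) r%:M) (block_mx 0 0 r%:M 0)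
    (block_mx 0 r%:M 0 0) (block_mx r%:M (const_mx q) (const_mx q) p%:M).

Definition W_ds : 'M[R]_((m + 1) + (1 + m)) :=
  let a := 1 / (m + 2)%:R in
  let b := (m + 1)%:R / (m + 2)%:R in
  ds_mx b a a.

Definition W_ds_tilde : 'M[R]_((m + 1) + (1 + m)) :=
  let alpha := 1 / (2 * m)%:R in
  let beta := 1 - 1 / (2 * m)%:R in
  ds_mx beta alpha (1 / 4).

End DoubleStar.

(* Main.v *)
Require Import Defs.
From mathcomp Require Import all_boot all_order all_algebra.
From mathcomp Require Import all_classical all_reals all_analysis.
From mathcomp Require Import zify ring lra.

Import Order.TTheory GRing.Theory Num.Theory.
Import numFieldNormedType.Exports.

Local Open Scope classical_set_scope.
Local Open Scope ring_scope.

(** Both matrices belong to one family: leaf diagonal [p], leaf-centre weight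
    [q], centre-centre weight [r], with rows summing to one, that is [p + q = 1]
    and [m q + 2 r = 1].

    Since the family is invariant under permuting the leaves of each star and
    under swapping the two stars, the space of vectors splits into orthogonal
    invariant pieces on which the action of [W - J] is explicit:
    - vectors supported on leaves with mean zero on each leaf set: [W - J] is
      multiplication by [p];
    - constant vectors, which [W - J] kills;
    - the vectors that take one value on all leaves, another on both centres, and
      have mean zero: a line, on which [W - J] acts by [2 r - q];
    - vectors that are constant on each leaf set and change sign when the stars
      are swapped: a plane, on which, in leaf and centre coordinates, [W - J]
      is [[p, q], [m q, 0]].
    The eigenvalues of the last block are the roots of [x^2 = p x + m q^2]: a
    positive root [l >= p], and a negative one of no larger absolute value. If
    [|2 r - q| <= p], the spectral norm of [W - J] is therefore [l]
    ([ds_lambda]). The lower bound comes from an explicit eigenvector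
    ([spectral_norm_eigen]). The upper bound is proved without diagonalizing:
    splitting off the variance of [x] on each leaf set ([sum_sqr_affine]) leaves a
    quadratic form in four variables, the two leaf means and the two centre
    values, which is written as a sum of nonnegative terms following the pieces
    above ([ds_quotient_bound]).

    In each of the two cases, [l] solves a quadratic whose discriminant is, up to
    a square factor, the radicand [S^2] of the statement, and [1 - l] is a multiple of [c - S] for which [(c - S) (c + S)] is explicit; this
    rationalizes [1 / (1 - l)] and gives both the closed form and the growth rate
    of the relaxation time.

    On the graph side, numbering the classes [L1], [c1], [c2], [L2] by levels
    0, 1, 2, 3 exhibits the double star as the pullback of the path on four
    vertices: adjacency means that the levels differ by one ([ds_edgeE]). The
    level moves by at most one along an edge, so leaves of opposite stars are
    at distance at least 3. *)

(** * Distances in finite graphs *)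

Lemma graph_dist_le (T : finType) (e : rel T) (u : T) (p : seq T) :
  path e u p -> (size p < #|T|)%N -> (graph_dist e u (last u p) <= size p)%N.
Proof.
move=> e_p lt_p; rewrite leqNgt; apply/negP => /(before_find 0%N).
rewrite nth_iota // add0n => no_walk.
suff: walk e u (last u p) (size p) by rewrite no_walk.
by apply/existsP; exists (in_tuple p); rewrite /= e_p eqxx.
Qed.

Lemma graph_dist_ge (T : finType) (e : rel T) (u v : T) (d : nat) :
    (d <= #|T|)%N -> (forall k, walk e u v k -> (d <= k)%N) ->
  (d <= graph_dist e u v)%N.
Proof.
move=> le_d walk_ge; rewrite /graph_dist.
have [has_w|no_w] := boolP (has (walk e u v) (iota 0 #|T|)).
  have := nth_find 0%N has_w; rewrite nth_iota ?add0n; first exact: walk_ge.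
  by move: has_w; rewrite has_find size_iota.
by move: no_w; rewrite has_find size_iota -leqNgt; exact: leq_trans.
Qed.

(** A potential that grows by at most one along each edge bounds walk lengths
    from below. *)
Lemma walk_potential (T : finType) (e : rel T) (h : T -> nat) (u v : T) k :
    (forall a b, e a b -> (h b <= (h a).+1)%N) ->
  walk e u v k -> (h v <= h u + k)%N.
Proof.
move=> h_e; rewrite /walk => /existsP[[p /= /eqP <-] /andP[/= e_p /eqP <-]].
elim: p u e_p => [|a s IHs] u /=; first by rewrite addn0.
case/andP=> /h_e h_a /IHs; lia.
Qed.

(** * The double star *)

(** The view that replaces a vertex by its expression as one of the four kinds,
    so that the sixteen kinds of pairs can be treated by case analysis. *)
Variant ds_vertex_spec (m : nat) : 'I_((m + 1) + (1 + m)) -> Type :=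
  | DsLeaf1 i : ds_vertex_spec m (ds_leaf1 i)
  | DsCenter1 : ds_vertex_spec m (ds_center1 m)
  | DsCenter2 : ds_vertex_spec m (ds_center2 m)
  | DsLeaf2 i : ds_vertex_spec m (ds_leaf2 i).

Lemma ds_vertexP (m : nat) (u : 'I_((m + 1) + (1 + m))) : ds_vertex_spec m u.
Proof.
case: (split_ordP u) => u' ->; case: (split_ordP u') => i ->.
- exact: DsLeaf1.
- by rewrite (ord1 i); exact: DsCenter1.
- by rewrite (ord1 i); exact: DsCenter2.
- exact: DsLeaf2.
Qed.

(** The class of a vertex along the chain [L1], [c1], [c2], [L2], numbered from 0;
    the three terms are booleans that locate the vertex with respect to the
    three class boundaries. *)
Definition ds_level (m : nat) (u : 'I_((m + 1) + (1 + m))) : nat :=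
  ((m <= u) + (m < u) + (m.+1 < u))%N.

Lemma ds_level_leaf1 m i : ds_level m (ds_leaf1 i) = 0%N.
Proof. by rewrite /ds_level /=; have := ltn_ord i; lia. Qed.

Lemma ds_level_center1 m : ds_level m (ds_center1 m) = 1%N.
Proof. by rewrite /ds_level /=; lia. Qed.

Lemma ds_level_center2 m : ds_level m (ds_center2 m) = 2%N.
Proof. by rewrite /ds_level /=; lia. Qed.

Lemma ds_level_leaf2 m i : ds_level m (ds_leaf2 i) = 3%N.
Proof. by rewrite /ds_level /=; lia. Qed.

Definition ds_levelE :=
  (ds_level_leaf1, ds_level_center1, ds_level_center2, ds_level_leaf2).

Lemma ds_level_neq m (u v : 'I_((m + 1) + (1 + m))) :
  ds_level m u != ds_level m v -> (u == v) = false.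
Proof. by move=> neq; apply/eqP => uv; rewrite uv eqxx in neq. Qed.

Lemma ds_arcE m (u v : 'I_((m + 1) + (1 + m))) :
  ds_arc u v = ((ds_level m u, ds_level m v) \in [:: (1, 0); (2, 3); (1, 2)]%N).
Proof.
have c1E w : (w == ds_center1 m) = (ds_level m w == 1%N).
  case: (ds_vertexP m w) => [i|||i]; rewrite ?ds_levelE ?eqxx //;
  by apply: ds_level_neq; rewrite !ds_levelE.
have c2E w : (w == ds_center2 m) = (ds_level m w == 2%N).
  case: (ds_vertexP m w) => [i|||i]; rewrite ?ds_levelE ?eqxx //;
  by apply: ds_level_neq; rewrite !ds_levelE.
have l1E : [exists i, v == ds_leaf1 i] = (ds_level m v == 0%N).
  apply/existsP/idP => [[i /eqP ->]|]; first by rewrite ds_levelE.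
  by case: (ds_vertexP m v) => [i|||i]; rewrite ds_levelE // => _; exists i.
have l2E : [exists i, v == ds_leaf2 i] = (ds_level m v == 3%N).
  apply/existsP/idP => [[i /eqP ->]|]; first by rewrite ds_levelE.
  by case: (ds_vertexP m v) => [i|||i]; rewrite ds_levelE // => _; exists i.
by rewrite /ds_arc !c1E !c2E l1E l2E !inE !xpair_eqE.
Qed.

(** Consecutive classes are completely joined and no other pairs are adjacent,
    hence adjacency depends on the levels only. *)
Lemma ds_edgeE m (u v : 'I_((m + 1) + (1 + m))) :
  ds_edge u v = (ds_level m v == (ds_level m u).+1)
             || (ds_level m u == (ds_level m v).+1).
Proof.
rewrite /ds_edge !ds_arcE.
by case: (ds_vertexP m u) => [i|||i]; case: (ds_vertexP m v) => [j|||j];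
  rewrite !ds_levelE.
Qed.

Lemma ds_short_walk m (u v : 'I_((m + 1) + (1 + m))) :
  exists p, [/\ path (@ds_edge m) u p, last u p = v & (size p <= 3)%N].
Proof.
pose c1 := ds_center1 m; pose c2 := ds_center2 m.
case: (ds_vertexP m u) => [i|||i]; case: (ds_vertexP m v) => [j|||j].
- by exists [:: c1; ds_leaf1 j]; rewrite /= !ds_edgeE !ds_levelE.
- by exists [:: c1]; rewrite /= !ds_edgeE !ds_levelE.
- by exists [:: c1; c2]; rewrite /= !ds_edgeE !ds_levelE.
- by exists [:: c1; c2; ds_leaf2 j]; rewrite /= !ds_edgeE !ds_levelE.
- by exists [:: ds_leaf1 j]; rewrite /= !ds_edgeE !ds_levelE.
- by exists [::].
- by exists [:: c2]; rewrite /= !ds_edgeE !ds_levelE.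
- by exists [:: c2; ds_leaf2 j]; rewrite /= !ds_edgeE !ds_levelE.
- by exists [:: c1; ds_leaf1 j]; rewrite /= !ds_edgeE !ds_levelE.
- by exists [:: c1]; rewrite /= !ds_edgeE !ds_levelE.
- by exists [::].
- by exists [:: ds_leaf2 j]; rewrite /= !ds_edgeE !ds_levelE.
- by exists [:: c2; c1; ds_leaf1 j]; rewrite /= !ds_edgeE !ds_levelE.
- by exists [:: c2; c1]; rewrite /= !ds_edgeE !ds_levelE.
- by exists [:: c2]; rewrite /= !ds_edgeE !ds_levelE.
- by exists [:: c2; ds_leaf2 j]; rewrite /= !ds_edgeE !ds_levelE.
Qed.

Lemma ds_simple_connected m : simple_connected_graph (@ds_edge m).
Proof.
split=> [u v|u|u v].
- by rewrite !ds_edgeE orbC.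
- by rewrite ds_edgeE orbb; apply/negbTE; rewrite neq_ltn ltnSn.
- have [p [e_p <- _]] := ds_short_walk m u v.
  by apply/connectP; exists p.
Qed.

(** The lower bound uses the level as a potential between two opposite leaves,
    which exist because [1 <= m]. *)
Lemma ds_diameter m : (1 <= m)%N -> diameter (@ds_edge m) = 3%N.
Proof.
move=> m_ge1; apply/eqP; rewrite eqn_leq; apply/andP; split.
  apply/bigmax_leqP => u _; apply/bigmax_leqP => v _.
  have [p [e_p <- p_le3]] := ds_short_walk m u v.
  apply: (leq_trans (graph_dist_le _ _ _ _ e_p _) p_le3).
  by apply: (leq_ltn_trans p_le3); rewrite card_ord; lia.
pose l1 := ds_leaf1 (Ordinal m_ge1); pose l2 := ds_leaf2 (Ordinal m_ge1).
apply: leq_trans (leq_bigmax l1); apply: leq_trans (leq_bigmax l2).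
apply: graph_dist_ge => [|k]; first by rewrite card_ord; lia.
move/(walk_potential _ _ (ds_level m)); rewrite !ds_levelE; apply=> a b.
by rewrite ds_edgeE; lia.
Qed.

(** * The spectral norm *)

Lemma euclidean_normZ (R : realType) n (c : R) (x : 'cV[R]_n) :
  euclidean_norm (c *: x) = `|c| * euclidean_norm x.
Proof.
rewrite /euclidean_norm -sqrtr_sqr -sqrtrM ?sqr_ge0 // mulr_sumr.
by congr Num.sqrt; apply: eq_bigr => i _; rewrite mxE exprMn.
Qed.

Lemma euclidean_norm_gt0 (R : realType) n (x : 'cV[R]_n) :
  x != 0 -> 0 < euclidean_norm x.
Proof.
move=> x_neq0; rewrite /euclidean_norm sqrtr_gt0 lt_def sumr_ge0 ?andbT; last first.
  by move=> i _; exact: sqr_ge0.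
apply: contra x_neq0; rewrite psumr_eq0; last by move=> i _; exact: sqr_ge0.
move/allP=> x0; apply/eqP/matrixP => i j; rewrite (ord1 j) mxE.
by have := x0 i (mem_index_enum i); rewrite sqrf_eq0 => /eqP.
Qed.

(** An eigenvector attains the supremum once it is scaled to unit length, so an
    upper bound on the quadratic form by the same constant settles the norm. *)
Lemma spectral_norm_eigen (R : realType) n (A : 'M[R]_n) (v : 'cV[R]_n) (l : R) :
    0 <= l -> v != 0 -> A *m v = l *: v ->
    (forall x : 'cV[R]_n,
       \sum_i ((A *m x) i 0) ^+ 2 <= l ^+ 2 * \sum_i x i 0 ^+ 2) ->
  spectral_norm A = l.
Proof.
move=> l_ge0 v_neq0 Av A_le.
have norm_le (x : 'cV[R]_n) : euclidean_norm x <= 1 -> euclidean_norm (A *m x) <= l.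
  move=> x_le1; rewrite -[leRHS]mulr1.
  apply: le_trans (ler_wpM2l l_ge0 x_le1).
  rewrite /euclidean_norm -{1}(ger0_norm l_ge0) -sqrtr_sqr -sqrtrM ?sqr_ge0 //.
  exact: ler_wsqrtr.
have v_gt0 := euclidean_norm_gt0 _ _ _ v_neq0.
pose w := (euclidean_norm v)^-1 *: v.
have w1 : euclidean_norm w = 1.
  by rewrite euclidean_normZ ger0_norm ?invr_ge0 ?ltW // mulVf ?gt_eqF.
have Aw : euclidean_norm (A *m w) = l.
  rewrite -scalemxAr Av scalerA mulrC -scalerA euclidean_normZ w1 mulr1.
  exact: ger0_norm.
apply/eqP; rewrite eq_le; apply/andP; split.
  apply: ge_sup => [|_ [x x_le1 <-]]; last exact: norm_le.
  by exists l, w => //=; rewrite w1.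
apply: ub_le_sup; first by exists l => _ [x x_le1 <-]; exact: norm_le.
by exists w => //=; rewrite w1.
Qed.

(** * The balanced double-star matrices *)

Lemma ds_sum (V : nmodType) m (F : 'I_((m + 1) + (1 + m)) -> V) :
  \sum_u F u = (\sum_i F (ds_leaf1 i) + F (ds_center1 m))
             + (F (ds_center2 m) + \sum_i F (ds_leaf2 i)).
Proof. by rewrite big_split_ord !big_split_ord /= !big_ord1. Qed.

Lemma ds_mxE (R : realType) m (p q r : R) (u v : 'I_((m + 1) + (1 + m))) :
  ds_mx m p q r u v =
    match ds_level m u, ds_level m v with
    | 0, 0 | 3, 3 => p *+ (u == v)
    | 0, 1 | 1, 0 | 2, 3 | 3, 2 => q
    | 1, 1 | 1, 2 | 2, 1 | 2, 2 => r
    | _, _ => 0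
    end.
Proof.
case: (ds_vertexP m u) => [i|||i]; case: (ds_vertexP m v) => [j|||j];
  rewrite !ds_levelE /ds_mx /ds_leaf1 /ds_center1 /ds_center2 /ds_leaf2
     ?block_mxEul ?block_mxEur ?block_mxEdl ?block_mxEdr
     ?block_mxEul ?block_mxEur ?block_mxEdl ?block_mxEdr ?mxE ?eqxx //=.
by rewrite !eq_shift.
Qed.

Lemma sum_delta_mul (R : realType) (I : finType) (p : R) (i : I) (y : I -> R) :
  \sum_j p *+ (i == j) * y j = p * y i.
Proof.
rewrite (bigD1 i) //= eqxx mulr1n big1 ?addr0 // => j /negbTE neq.
by rewrite eq_sym neq mulr0n mul0r.
Qed.

Section Action.
Variables (R : realType) (m : nat) (p q r : R) (x : 'cV[R]_((m + 1) + (1 + m))).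

Lemma ds_mx_mul_leaf1 i :
  (ds_mx m p q r *m x) (ds_leaf1 i) 0
  = p * x (ds_leaf1 i) 0 + q * x (ds_center1 m) 0.
Proof.
rewrite mxE ds_sum !ds_mxE !ds_levelE.
under eq_bigr do rewrite ds_mxE !ds_levelE !eq_shift.
rewrite sum_delta_mul; under eq_bigr do rewrite ds_mxE !ds_levelE mul0r.
by rewrite big1_eq mul0r !addr0.
Qed.

Lemma ds_mx_mul_center1 :
  (ds_mx m p q r *m x) (ds_center1 m) 0
  = q * (\sum_i x (ds_leaf1 i) 0) + r * (x (ds_center1 m) 0 + x (ds_center2 m) 0).
Proof.
rewrite mxE ds_sum !ds_mxE !ds_levelE.
under eq_bigr do rewrite ds_mxE !ds_levelE.
rewrite -mulr_sumr [X in _ + (_ + X)]big1 => [|j _]; last first.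
  by rewrite ds_mxE !ds_levelE mul0r.
by ring.
Qed.

Lemma ds_mx_mul_center2 :
  (ds_mx m p q r *m x) (ds_center2 m) 0
  = q * (\sum_i x (ds_leaf2 i) 0) + r * (x (ds_center1 m) 0 + x (ds_center2 m) 0).
Proof.
rewrite mxE ds_sum !ds_mxE !ds_levelE.
under eq_bigr do rewrite ds_mxE !ds_levelE mul0r.
rewrite big1_eq; under eq_bigr do rewrite ds_mxE !ds_levelE.
by rewrite -mulr_sumr; ring.
Qed.

Lemma ds_mx_mul_leaf2 i :
  (ds_mx m p q r *m x) (ds_leaf2 i) 0
  = p * x (ds_leaf2 i) 0 + q * x (ds_center2 m) 0.
Proof.
rewrite mxE ds_sum !ds_mxE !ds_levelE.
under eq_bigr do rewrite ds_mxE !ds_levelE mul0r.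
rewrite big1_eq mul0r; under eq_bigr do rewrite ds_mxE !ds_levelE !eq_shift.
by rewrite sum_delta_mul; ring.
Qed.

End Action.

Definition ds_mulE :=
  (ds_mx_mul_leaf1, ds_mx_mul_center1, ds_mx_mul_center2, ds_mx_mul_leaf2).

(** The row sums [p + q] of a leaf and [m q + 2 r] of a centre are read off the
    image of the all-ones vector; the column sums follow by symmetry. *)
Lemma ds_mixing (R : realType) m (p q r : R) :
    0 <= p -> 0 < q -> 0 < r -> p + q = 1 -> m%:R * q + 2 * r = 1 ->
  mixing_matrix (@ds_edge m) (ds_mx m p q r).
Proof.
move=> p_ge0 q_gt0 r_gt0 pq1 qr1.
have W_ge0 u v : 0 <= ds_mx m p q r u v.
  rewrite ds_mxE; case: (ds_vertexP m u) => [i|||i]; case: (ds_vertexP m v) => [j|||j];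
    by rewrite !ds_levelE ?mulrn_wge0 // ?ltW.
have W_sym : (ds_mx m p q r)^T = ds_mx m p q r.
  apply/matrixP => u v; rewrite mxE !ds_mxE.
  case: (ds_vertexP m u) => [i|||i]; case: (ds_vertexP m v) => [j|||j];
    by rewrite !ds_levelE // eq_sym.
have W_row u : \sum_v ds_mx m p q r u v = 1.
  transitivity ((ds_mx m p q r *m const_mx 1 : 'cV_(_)) u 0).
    by rewrite mxE; apply: eq_bigr => v _; rewrite [const_mx 1 _ _]mxE mulr1.
  case: (ds_vertexP m u) => [i|||i]; rewrite ds_mulE !mxE ?mulr1 //.
  - under eq_bigr do rewrite mxE.
    by rewrite sumr_const card_ord -[RHS]qr1; ring.
  - under eq_bigr do rewrite mxE.
    by rewrite sumr_const card_ord -[RHS]qr1; ring.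
split=> //.
  split=> // v; rewrite -[RHS](W_row v); apply: eq_bigr => u _.
  by rewrite -[in LHS]W_sym mxE.
move=> u v; rewrite ds_mxE ds_edgeE.
case: (ds_vertexP m u) => [i|||i]; case: (ds_vertexP m v) => [j|||j];
  by rewrite !ds_levelE ?eqxx //= => [/negbTE ->]; rewrite ltxx.
Qed.

Lemma ds_averaging_mul (R : realType) m (x : 'cV[R]_((m + 1) + (1 + m))) u :
  (averaging_mx R ((m + 1) + (1 + m)) *m x) u 0 = (\sum_v x v 0) / (2 * m%:R + 2).
Proof.
rewrite mxE mulr_suml; apply: eq_bigr => v _.
rewrite !mxE big_ord1 !mxE !mulr1 mulrC; congr (_ * _^-1).
by rewrite !natrD; ring.
Qed.

(** Decomposition of a sum of squares into the contribution of the mean and a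
    variance: it separates the vectors with mean zero on a leaf set, on which the
    double-star matrix acts as a scalar, from the constant ones. *)
Lemma sum_sqr_affine (R : realType) m (w : 'I_m -> R) (c d : R) : (0 < m)%N ->
  let mean := (\sum_i w i) / m%:R in
  \sum_i (c * w i + d) ^+ 2 =
    m%:R * (c * mean + d) ^+ 2 + c ^+ 2 * \sum_i (w i - mean) ^+ 2.
Proof.
move=> m_gt0 mean.
have dev0 : \sum_i (w i - mean) = 0.
  rewrite sumrB sumr_const card_ord -[mean *+ m]mulr_natr divfK ?subrr //.
  by rewrite pnatr_eq0 -lt0n.
transitivity (\sum_i ((c * mean + d) ^+ 2 + (2 * c * (c * mean + d)) * (w i - mean)
                      + c ^+ 2 * (w i - mean) ^+ 2)).
  by apply: eq_bigr => i _; ring.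
rewrite !big_split /= sumr_const card_ord -!mulr_sumr dev0 mulr0 addr0.
by rewrite mulr_natl.
Qed.

Lemma leaf_root_le (R : realType) (M p q l : R) :
  0 < M -> 0 < q -> 0 < l -> l ^+ 2 = p * l + M * q ^+ 2 -> p <= l.
Proof.
move=> M_gt0 q_gt0 l_gt0 l_root.
rewrite -(ler_pM2r l_gt0) -expr2 l_root lerDl.
by rewrite mulr_ge0 ?sqr_ge0 // ltW.
Qed.

(** The bound [ |(W - J) x| <= l |x| ] for [x] constant on each leaf set, with leaf
    values [a1], [a2] and centre values [y], [z]; here [M] is the number of leaves
    of a star and [s] is the mean of [x]. *)
Lemma ds_quotient_bound (R : realType) (M p q r l a1 y z a2 s : R) :
    0 < M -> 0 <= p -> 0 < q -> p + q = 1 -> M * q + 2 * r = 1 ->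
    `|2 * r - q| <= p -> 0 < l -> l ^+ 2 = p * l + M * q ^+ 2 ->
    s * (2 * M + 2) = M * a1 + y + (z + M * a2) ->
  M * (p * a1 + q * y - s) ^+ 2 + (q * (M * a1) + r * (y + z) - s) ^+ 2
  + ((q * (M * a2) + r * (y + z) - s) ^+ 2 + M * (p * a2 + q * z - s) ^+ 2)
  <= l ^+ 2 * (M * a1 ^+ 2 + y ^+ 2 + (z ^+ 2 + M * a2 ^+ 2)).
Proof.
move=> M_gt0 p_ge0 q_gt0 pq1 qr1 rq_le_p l_gt0 l_root sE.
have p_le_l := leaf_root_le _ _ _ _ _ M_gt0 q_gt0 l_gt0 l_root.
(* Besides the mean s, the coordinates are t along (1, - M) for the leaf and
   centre values of the swap-invariant part, and (f, g) for the leaf and centre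
   values of the part that the swap negates. *)
pose t := (a1 + a2) / 2 - s; pose f := (a1 - a2) / 2; pose g := (y - z) / 2.
have a1E : a1 = s + t + f by rewrite /t /f; field.
have a2E : a2 = s + t - f by rewrite /t /f; field.
have yE : y = s - M * t + g by rewrite /t /g; lra.
have zE : z = s - M * t - g by rewrite /t /g; lra.
have symm : (2 * r - q) ^+ 2 * t ^+ 2 <= l ^+ 2 * t ^+ 2.
  rewrite ler_wpM2r ?sqr_ge0 // -real_normK ?num_real // ler_pXn2r ?nnegrE //.
    exact: le_trans p_le_l.
  exact: ltW.
(* Since l is an eigenvalue, the difference of the two sides is degenerate: it is
   a multiple of the square of a linear form that vanishes on the eigenvector. *)
have anti : M * (p * f + q * g) ^+ 2 + (M * q * f) ^+ 2
            <= l ^+ 2 * (M * f ^+ 2 + g ^+ 2).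
  rewrite -subr_ge0.
  (* Eliminating M through the equation of l makes the identity one of rational
     functions. *)
  have ME : M = (l ^+ 2 - p * l) / q ^+ 2.
    by rewrite l_root; field; rewrite gt_eqF.
  have -> : l ^+ 2 * (M * f ^+ 2 + g ^+ 2)
          - (M * (p * f + q * g) ^+ 2 + (M * q * f) ^+ 2)
          = p / l * (M * q * f - l * g) ^+ 2.
    by rewrite ME; field; rewrite !gt_eqF.
  by rewrite mulr_ge0 ?sqr_ge0 // divr_ge0 // ltW.
have pE : p = 1 - q by lra.
have rE : r = (1 - M * q) / 2 by lra.
rewrite -subr_ge0.
have -> : l ^+ 2 * (M * a1 ^+ 2 + y ^+ 2 + (z ^+ 2 + M * a2 ^+ 2)) -
  (M * (p * a1 + q * y - s) ^+ 2 + (q * (M * a1) + r * (y + z) - s) ^+ 2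
  + ((q * (M * a2) + r * (y + z) - s) ^+ 2 + M * (p * a2 + q * z - s) ^+ 2))
  = 2 * M * (1 + M) * (l ^+ 2 * t ^+ 2 - (2 * r - q) ^+ 2 * t ^+ 2)
  + 2 * (l ^+ 2 * (M * f ^+ 2 + g ^+ 2)
         - (M * (p * f + q * g) ^+ 2 + (M * q * f) ^+ 2))
  + (2 * M + 2) * l ^+ 2 * s ^+ 2.
  by rewrite a1E a2E yE zE pE rE; field.
rewrite -subr_ge0 in symm; rewrite -subr_ge0 in anti.
have M_ge0 := ltW M_gt0.
have ? := mulr_ge0 M_ge0 symm; have ? := mulr_ge0 M_ge0 (mulr_ge0 M_ge0 symm).
have ls_ge0 : 0 <= l ^+ 2 * s ^+ 2 by rewrite mulr_ge0 ?sqr_ge0.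
have ? := mulr_ge0 M_ge0 ls_ge0.
lra.
Qed.

Lemma ds_centered_mul (R : realType) m (A : 'M[R]_((m + 1) + (1 + m)))
    (x : 'cV[R]_((m + 1) + (1 + m))) u :
  ((A - averaging_mx R ((m + 1) + (1 + m))) *m x) u 0
  = (A *m x) u 0 - (\sum_v x v 0) / (2 * m%:R + 2).
Proof. by rewrite mulmxBl [LHS]mxE [X in _ + X]mxE ds_averaging_mul. Qed.

(** The condition on [2 * r - q] says that the eigenvalue on the swap-invariant line
    is dominated by [p], hence by [l]. *)
Lemma ds_lambda (R : realType) m (p q r l : R) : (0 < m)%N ->
    0 <= p -> 0 < q -> p + q = 1 -> m%:R * q + 2 * r = 1 ->
    `|2 * r - q| <= p -> 0 < l -> l ^+ 2 = p * l + m%:R * q ^+ 2 ->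
  lambda_mix (ds_mx m p q r) = l.
Proof.
move=> m_gt0 p_ge0 q_gt0 pq1 qr1 rq_le_p l_gt0 l_root.
(* The eigenvector is negated by the swap; (l, m q) solves m q f = l g, the
   centre row of the 2 x 2 eigenproblem. *)
pose v : 'cV[R]_((m + 1) + (1 + m)) :=
  \col_u nth 0 [:: l; m%:R * q; - (m%:R * q); - l] (ds_level m u).
have vE u : v u 0 = nth 0 [:: l; m%:R * q; - (m%:R * q); - l] (ds_level m u).
  by rewrite mxE.
rewrite /lambda_mix; apply: (@spectral_norm_eigen R _ _ v) => [|||x]; first exact: ltW.
- apply/eqP => /matrixP/(_ (ds_leaf1 (Ordinal m_gt0)) 0).
  by rewrite vE ds_levelE mxE /= => l0; rewrite l0 ltxx in l_gt0.
- have sum_const (c : R) : \sum_(i < m) c = m%:R * c.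
    by rewrite sumr_const card_ord mulr_natl.
  have sum1 : \sum_i v (ds_leaf1 i) 0 = m%:R * l.
    by under eq_bigr do rewrite vE ds_levelE; rewrite sum_const.
  have sum2 : \sum_i v (ds_leaf2 i) 0 = - (m%:R * l).
    by under eq_bigr do rewrite vE ds_levelE; rewrite sum_const mulrN.
  apply/matrixP => u j; rewrite (ord1 j) {j} ds_centered_mul [RHS]mxE.
  rewrite ds_sum sum1 sum2 !vE !ds_levelE /=.
  rewrite [X in X / _](_ : _ = 0) ?mul0r ?subr0; last by ring.
  case: (ds_vertexP m u) => [i|||i]; rewrite ds_mulE ?sum1 ?sum2 !vE !ds_levelE /=.
  + by transitivity (l ^+ 2); [rewrite l_root|]; ring.
  + by ring.
  + by ring.
  + by transitivity (- l ^+ 2); [rewrite l_root|]; ring.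
- set s := (\sum_u x u 0) / (2 * m%:R + 2).
  have M_gt0 : 0 < m%:R :> R by rewrite ltr0n.
  pose y1 := x (ds_center1 m) 0; pose y2 := x (ds_center2 m) 0.
  pose S1 := \sum_i x (ds_leaf1 i) 0; pose S2 := \sum_i x (ds_leaf2 i) 0.
  pose V1 := \sum_i (x (ds_leaf1 i) 0 - S1 / m%:R) ^+ 2.
  pose V2 := \sum_i (x (ds_leaf2 i) 0 - S2 / m%:R) ^+ 2.
  (* V1 and V2 are the squared norms of the parts of x with mean zero on a leaf
     set, which the matrix multiplies by p. *)
  have leaf1 : \sum_i ((ds_mx m p q r *m x) (ds_leaf1 i) 0 - s) ^+ 2
      = m%:R * (p * (S1 / m%:R) + q * y1 - s) ^+ 2 + p ^+ 2 * V1.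
    under eq_bigr do rewrite ds_mx_mul_leaf1 -addrA.
    by rewrite sum_sqr_affine // addrA.
  have leaf2 : \sum_i ((ds_mx m p q r *m x) (ds_leaf2 i) 0 - s) ^+ 2
      = m%:R * (p * (S2 / m%:R) + q * y2 - s) ^+ 2 + p ^+ 2 * V2.
    under eq_bigr do rewrite ds_mx_mul_leaf2 -addrA.
    by rewrite sum_sqr_affine // addrA.
  have norm1 : \sum_i x (ds_leaf1 i) 0 ^+ 2 = m%:R * (S1 / m%:R) ^+ 2 + V1.
    transitivity (\sum_i (1 * x (ds_leaf1 i) 0 + 0) ^+ 2).
      by apply: eq_bigr => i _; rewrite mul1r addr0.
    by rewrite sum_sqr_affine // mul1r addr0 expr1n mul1r.
  have norm2 : \sum_i x (ds_leaf2 i) 0 ^+ 2 = m%:R * (S2 / m%:R) ^+ 2 + V2.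
    transitivity (\sum_i (1 * x (ds_leaf2 i) 0 + 0) ^+ 2).
      by apply: eq_bigr => i _; rewrite mul1r addr0.
    by rewrite sum_sqr_affine // mul1r addr0 expr1n mul1r.
  under eq_bigr do rewrite ds_centered_mul -/s.
  rewrite !ds_sum leaf1 leaf2 norm1 norm2 ds_mx_mul_center1 ds_mx_mul_center2.
  rewrite -/y1 -/y2 -/S1 -/S2.
  have M2 : 2 * m%:R + 2 != 0 :> R by rewrite gt_eqF //; lra.
  have divM (a : R) : m%:R * (a / m%:R) = a by rewrite mulrC divfK // gt_eqF.
  have sE : s * (2 * m%:R + 2)
      = m%:R * (S1 / m%:R) + y1 + (y2 + m%:R * (S2 / m%:R)).
    by rewrite /s divfK // ds_sum !divM.
  have := ds_quotient_bound _ _ _ _ _ _ _ _ _ _ _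
    M_gt0 p_ge0 q_gt0 pq1 qr1 rq_le_p l_gt0 l_root sE.
  have pl : p ^+ 2 <= l ^+ 2.
    have p_le_l := leaf_root_le _ _ _ _ _ M_gt0 q_gt0 l_gt0 l_root.
    by rewrite ler_pXn2r ?nnegrE // ltW.
  have : p ^+ 2 * V1 <= l ^+ 2 * V1.
    by rewrite ler_wpM2r // sumr_ge0 // => i _; exact: sqr_ge0.
  have : p ^+ 2 * V2 <= l ^+ 2 * V2.
    by rewrite ler_wpM2r // sumr_ge0 // => i _; exact: sqr_ge0.
  rewrite !divM; lra.
Qed.

(** * Spectral gaps and their growth *)

Lemma W_dsE (R : realType) m :
  W_ds m R = ds_mx m ((m%:R + 1) / (m%:R + 2)) (1 / (m%:R + 2)) (1 / (m%:R + 2)).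
Proof. by rewrite /W_ds !natrD. Qed.

Lemma W_ds_tildeE (R : realType) m :
  W_ds_tilde m R = ds_mx m (1 - 1 / (2 * m%:R)) (1 / (2 * m%:R)) (1 / 4).
Proof. by rewrite /W_ds_tilde natrM. Qed.

Lemma W_ds_mixing (R : realType) m : mixing_matrix (@ds_edge m) (W_ds m R).
Proof.
have M_ge0 : 0 <= m%:R :> R by [].
have M2 : m%:R + 2 != 0 :> R by rewrite gt_eqF //; lra.
have inv_gt0 : 0 < 1 / (m%:R + 2) :> R by rewrite divr_gt0 //; lra.
rewrite W_dsE; apply: ds_mixing => //; by field.
Qed.

Lemma W_ds_tilde_mixing (R : realType) m : (1 <= m)%N ->
  mixing_matrix (@ds_edge m) (W_ds_tilde m R).
Proof.
move=> m_ge1; have M_ge1 : 1 <= m%:R :> R by rewrite ler1n.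
have M0 : m%:R != 0 :> R by rewrite gt_eqF //; lra.
rewrite W_ds_tildeE; apply: ds_mixing.
- by rewrite subr_ge0 ler_pdivrMr; lra.
- by rewrite divr_gt0 //; lra.
- by lra.
- by field.
- by field.
Qed.

(** The quadratic [x^2 = p x + m q^2] has discriminant [S^2 / (m + 2)^2], and
    [1 - l = (m + 3 - S) / (2 (m + 2))] is inverted by the conjugate, because
    [(m + 3)^2 - S^2 = 8]. This constant gap is why the relaxation time is
    quadratic. *)
Lemma W_ds_spectrum (R : realType) m : (1 <= m)%N ->
  let S : R := Num.sqrt (m%:R ^+ 2 + 6 * m%:R + 1) in
  [/\ lambda_mix (W_ds m R) = (m%:R + 1 + S) / (2 * (m%:R + 2)),
      lambda_mix (W_ds m R) < 1
    & tau_mix (W_ds m R) = (m%:R + 2) * (m%:R + 3 + S) / 4].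
Proof.
move=> m_ge1 S; have M_ge1 : 1 <= m%:R :> R by rewrite ler1n.
set M : R := m%:R in S M_ge1 *.
have S_ge0 : 0 <= S by exact: sqrtr_ge0.
have S2 : S ^+ 2 = M ^+ 2 + 6 * M + 1.
  by rewrite sqr_sqrtr // !addr_ge0 ?sqr_ge0 //; lra.
have S_lt : S < M + 3.
  by rewrite -(ltr_pXn2r (ltn0Sn 1)) ?nnegrE ?S2 //; nra.
have M2 : M + 2 != 0 by rewrite gt_eqF //; lra.
have lambdaE : lambda_mix (W_ds m R) = (M + 1 + S) / (2 * (M + 2)).
  rewrite W_dsE -/M; apply: ds_lambda => //; rewrite -/M.
  - by rewrite divr_ge0 //; lra.
  - by rewrite divr_gt0 //; lra.
  - by field.
  - by field.
  - have -> : 2 * (1 / (M + 2)) - 1 / (M + 2) = 1 / (M + 2) by field.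
    have inv_ge0 : 0 <= 1 / (M + 2) by rewrite divr_ge0 //; lra.
    by rewrite ger0_norm // ler_pM2r ?invr_gt0; lra.
  - by rewrite divr_gt0 //; lra.
  - have -> : ((M + 1 + S) / (2 * (M + 2))) ^+ 2
        = ((M + 1) ^+ 2 + 2 * (M + 1) * S + S ^+ 2) / (4 * (M + 2) ^+ 2).
      by field.
    by rewrite S2; field.
split=> //; first by rewrite lambdaE ltr_pdivrMr; lra.
rewrite /tau_mix lambdaE.
have -> : 1 - (M + 1 + S) / (2 * (M + 2)) = (M + 3 - S) / (2 * (M + 2)).
  by field.
have gap : (M + 3 - S) * (M + 3 + S) = 8.
  transitivity ((M + 3) ^+ 2 - S ^+ 2); first by ring.
  by rewrite S2; ring.
have S_neq : M + 3 - S != 0 by rewrite subr_eq0 gt_eqF.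
have -> : M + 3 + S = 8 / (M + 3 - S) by rewrite -gap [RHS]mulrC mulKf.
by field; rewrite S_neq.
Qed.

(** Here [1 - l = (2 m + 1 - S) / (4 m)] with [S^2 = 4 m^2 + 1], and the conjugate
    product [(2 m + 1)^2 - S^2 = 4 m] is linear in [m]: it cancels the denominator
    and one order of growth is saved. *)
Lemma W_ds_tilde_spectrum (R : realType) m : (1 <= m)%N ->
  [/\ lambda_mix (W_ds_tilde m R) =
        (1 - 1 / (2 * m%:R) + Num.sqrt (1 + 1 / (4 * m%:R ^+ 2))) / 2,
      lambda_mix (W_ds_tilde m R) < 1
    & tau_mix (W_ds_tilde m R) = 2 * m%:R + 1 + Num.sqrt (4 * m%:R ^+ 2 + 1)].
Proof.
move=> m_ge1; have M_ge1 : 1 <= m%:R :> R by rewrite ler1n.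
set M : R := m%:R in M_ge1 *; set S := Num.sqrt (4 * M ^+ 2 + 1).
have S_ge0 : 0 <= S by exact: sqrtr_ge0.
have S2 : S ^+ 2 = 4 * M ^+ 2 + 1 by rewrite sqr_sqrtr //; nra.
have S_lt : S < 2 * M + 1.
  by rewrite -(ltr_pXn2r (ltn0Sn 1)) ?nnegrE ?S2 //; nra.
have M0 : M != 0 by rewrite gt_eqF //; lra.
have -> : Num.sqrt (1 + 1 / (4 * M ^+ 2)) = S / (2 * M).
  have M2_ge0 : 0 <= S / (2 * M) by rewrite divr_ge0 //; lra.
  rewrite -[RHS](ger0_norm M2_ge0) -sqrtr_sqr; congr Num.sqrt.
  by rewrite expr_div_n S2; field.
have lambdaE : lambda_mix (W_ds_tilde m R) = (1 - 1 / (2 * M) + S / (2 * M)) / 2.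
  have inv_gt0 : 0 < 1 / (2 * M) by rewrite divr_gt0 //; lra.
  have inv_le : 1 / (2 * M) <= 1 / 2 by rewrite ler_pdivrMr; lra.
  rewrite W_ds_tildeE -/M; apply: ds_lambda => //; rewrite -/M.
  - by lra.
  - by field.
  - by field.
  - by rewrite ger0_norm; lra.
  - have SM_ge0 : 0 <= S / (2 * M) by rewrite divr_ge0 //; lra.
    by lra.
  - have -> : ((1 - 1 / (2 * M) + S / (2 * M)) / 2) ^+ 2
        = ((2 * M - 1) ^+ 2 + 2 * (2 * M - 1) * S + S ^+ 2) / (16 * M ^+ 2).
      by field.
    by rewrite S2; field.
have gapE : 1 - (1 - 1 / (2 * M) + S / (2 * M)) / 2 = (2 * M + 1 - S) / (4 * M).
  by field.
split=> //.
  by rewrite lambdaE -subr_gt0 gapE divr_gt0 //; lra.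
rewrite /tau_mix lambdaE gapE.
have gap : (2 * M + 1 - S) * (2 * M + 1 + S) = 4 * M.
  transitivity ((2 * M + 1) ^+ 2 - S ^+ 2); first by ring.
  by rewrite S2; ring.
have S_neq : 2 * M + 1 - S != 0 by rewrite subr_eq0 gt_eqF.
have -> : 2 * M + 1 + S = 4 * M / (2 * M + 1 - S) by rewrite -gap [RHS]mulrC mulKf.
by field; rewrite S_neq M0.
Qed.

Lemma bigTheta_eventually (R : realType) (f g : nat -> R^o) (c C : R) :
    0 < c -> 0 < C ->
    (forall m, (1 <= m)%N -> 0 <= g m /\ c * g m <= f m <= C * g m) ->
  f \is 'Theta_\oo g.
Proof.
move=> c_gt0 C_gt0 fg; apply/asboolP; exists (c, C); first by rewrite /= c_gt0.
exists 1%N => // m /= m_ge1; have [g_ge0 /andP[cg_f f_Cg]] := fg m m_ge1.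
have f_ge0 : 0 <= f m by apply: le_trans cg_f; rewrite mulr_ge0 // ltW.
by rewrite (ger0_norm g_ge0) (ger0_norm f_ge0).
Qed.

(** The bounds [0 <= S <= m + 3] already give the order of growth. *)
Lemma tau_W_ds_Theta (R : realType) :
  (fun m : nat => tau_mix (W_ds m R) : R^o)
    \is 'Theta_\oo (fun m : nat => (2 * m + 2)%:R ^+ 2 : R^o).
Proof.
apply: (bigTheta_eventually R _ _ 16^-1 1) => // m m_ge1.
split; first exact: sqr_ge0.
have [_ _ ->] := W_ds_spectrum R _ m_ge1.
have M_ge1 : 1 <= m%:R :> R by rewrite ler1n.
rewrite natrD natrM; set M : R := m%:R in M_ge1 *; set S := Num.sqrt _.
have S_ge0 : 0 <= S by exact: sqrtr_ge0.
have S_le : S <= M + 3.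
  have -> : M + 3 = Num.sqrt ((M + 3) ^+ 2) by rewrite sqrtr_sqr ger0_norm //; lra.
  by apply: ler_wsqrtr; lra.
have MS_ge0 : 0 <= (M + 2) * S by rewrite mulr_ge0 //; lra.
have MS_le : (M + 2) * S <= (M + 2) * (M + 3) by rewrite ler_wpM2l //; lra.
by apply/andP; split; nra.
Qed.

Lemma tau_W_ds_tilde_Theta (R : realType) :
  (fun m : nat => tau_mix (W_ds_tilde m R) : R^o)
    \is 'Theta_\oo (fun m : nat => (2 * m + 2)%:R : R^o).
Proof.
apply: (bigTheta_eventually R _ _ 2^-1 2) => // m m_ge1.
split; first exact: ler0n.
have [_ _ ->] := W_ds_tilde_spectrum R _ m_ge1.
have M_ge1 : 1 <= m%:R :> R by rewrite ler1n.
rewrite natrD natrM; set M : R := m%:R in M_ge1 *; set S := Num.sqrt _.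
have S_ge0 : 0 <= S by exact: sqrtr_ge0.
have S_le : S <= 2 * M + 1.
  have -> : 2 * M + 1 = Num.sqrt ((2 * M + 1) ^+ 2) by rewrite sqrtr_sqr ger0_norm //; lra.
  by apply: ler_wsqrtr; lra.
by apply/andP; split; lra.
Qed.

Theorem lemma2p4 (R : realType) :
  (forall m : nat, (1 <= m)%N ->
    [/\ simple_connected_graph (@ds_edge m),
        mixing_matrix (@ds_edge m) (W_ds m R),
        mixing_matrix (@ds_edge m) (W_ds_tilde m R)
      & diameter (@ds_edge m) = 3%N] /\
    [/\ lambda_mix (W_ds m R) =
          (m%:R + 1 + Num.sqrt (m%:R ^+ 2 + 6 * m%:R + 1)) / (2 * (m%:R + 2)),
        lambda_mix (W_ds m R) < 1
      & tau_mix (W_ds m R) =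
          (m%:R + 2) * (m%:R + 3 + Num.sqrt (m%:R ^+ 2 + 6 * m%:R + 1)) / 4] /\
    [/\ lambda_mix (W_ds_tilde m R) =
          (1 - 1 / (2 * m%:R) + Num.sqrt (1 + 1 / (4 * m%:R ^+ 2))) / 2,
        lambda_mix (W_ds_tilde m R) < 1
      & tau_mix (W_ds_tilde m R) =
          2 * m%:R + 1 + Num.sqrt (4 * m%:R ^+ 2 + 1)]) /\
  (fun m : nat => tau_mix (W_ds m R) : R^o)
    \is 'Theta_\oo (fun m : nat => (2 * m + 2)%:R ^+ 2 : R^o) /\
  (fun m : nat => tau_mix (W_ds_tilde m R) : R^o)
    \is 'Theta_\oo (fun m : nat => (2 * m + 2)%:R : R^o).
Proof.
split; last by split; [exact: tau_W_ds_Theta|exact: tau_W_ds_tilde_Theta].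
move=> m m_ge1; split; last first.
  by split; [exact: W_ds_spectrum|exact: W_ds_tilde_spectrum].
split.
- exact: ds_simple_connected.
- exact: W_ds_mixing.
- exact: W_ds_tilde_mixing.
- exact: ds_diameter.
Qed.
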